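(* Let $\mathcal A$ be a category with a factorization system $(\mathcal E,\mathcal M)$ such that the pullback of any morphism in $\mathcal M$ along any morphism of $\mathcal A$ exists and is in $\mathcal M$, every morphism in $\mathcal M$ is a monomorphism, and every object of $\mathcal A$ has only finitely many $\mathcal M$-subobjects. Let $\mathcal X$ be any additive category with finite direct sums and split idempotents. Then there is an equivalence of categories $$[\mathrm{Par}\mathcal A,\mathcal X]\simeq[\mathcal E,\mathcal X].$$
   Context: Factorization systems are orthogonal ones in the sense of Freyd–Kelly. An $\mathcal M$-subobject of $X$ is an isomorphism class of morphisms in $\mathcal M$ with codomain $X$. $\mathcal E$ is identified with the subcategory of $\mathcal A$ having all the objects of $\mathcal A$ but only the morphisms in $\mathcal E$. $\mathrm{Par}\mathcal A$ is the category with the same objects as $\mathcal A$ whose morphisms $X\to Y$ are isomorphism classes of $\mathcal M$-partial maps, that is, of spans $X\xleftarrow{f_0}U\xrightarrow{f_1}Y$ in $\mathcal A$ with $f_0\in\mathcal M$; composition is composition of spans by pullback. $[\mathcal C,\mathcal X]$ denotes the category of all functors $\mathcal C\to\mathcal X$ and natural transformations. *)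

(* Defs.v *)
From HB Require Import structures.
From mathcomp Require Import all_boot all_order all_algebra.
From mathcomp Require Import all_classical.

Set Implicit Arguments.
Unset Strict Implicit.
Unset Printing Implicit Defensive.

Import GRing.Theory.
Local Open Scope classical_set_scope.

Record category : Type := Category {
  Ob :> Type;
  Mor : Ob -> Ob -> Type;
  id_mor : forall a, Mor a a;
  compm : forall a b c, Mor b c -> Mor a b -> Mor a c;
  comp1m : forall a b (f : Mor a b), compm (id_mor b) f = f;
  compm1 : forall a b (f : Mor a b), compm f (id_mor a) = f;
  compmA : forall a b c d (h : Mor c d) (g : Mor b c) (f : Mor a b),
    compm h (compm g f) = compm (compm h g) f }.

Declare Scope cat_scope.
Delimit Scope cat_scope with cat.
Local Open Scope cat_scope.

Notation "g '\oc' f" := (compm g f)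
  (at level 40, left associativity, format "g  \oc  f") : cat_scope.

Record functor (C D : category) : Type := Functor {
  fobj :> C -> D;
  fmor : forall a b : C, Mor a b -> Mor (fobj a) (fobj b);
  fmor1 : forall a, fmor (id_mor a) = id_mor (fobj a);
  fmorM : forall a b c (g : Mor b c) (f : Mor a b),
    fmor (g \oc f) = fmor g \oc fmor f }.

Record nattrans (C D : category) (F G : functor C D) : Type := NatTrans {
  ntc :> forall a : C, Mor (F a) (G a);
  ntcN : forall (a b : C) (f : Mor a b),
    ntc b \oc fmor F f = fmor G f \oc ntc a }.

Lemma nattransP (C D : category) (F G : functor C D) (s t : nattrans F G) :
  (forall a, s a = t a) -> s = t.
Proof.
case: s t => [s sN] [t tN] /= st.
have {}st : s = t by apply: functional_extensionality_dep.
by subst t; congr NatTrans; apply: Prop_irrelevance.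
Qed.

Section FunctorCategory.
Variables C D : category.

Program Definition nat_id (F : functor C D) : nattrans F F :=
  @NatTrans C D F F (fun a => id_mor (F a)) _.
Next Obligation. by move=> F a b f; rewrite comp1m compm1. Qed.

Program Definition nat_comp (F G H : functor C D)
    (t : nattrans G H) (s : nattrans F G) : nattrans F H :=
  @NatTrans C D F H (fun a => t a \oc s a) _.
Next Obligation. by move=> F G H t s a b f; rewrite -compmA ntcN compmA ntcN compmA. Qed.

Program Definition functor_category : category :=
  @Category (functor C D) (@nattrans C D) nat_id nat_comp _ _ _.
Next Obligation. by move=> F G s; apply: nattransP => a /=; rewrite comp1m. Qed.
Next Obligation. by move=> F G s; apply: nattransP => a /=; rewrite compm1. Qed.
Next Obligation. by move=> F G H K u t s; apply: nattransP => a /=; rewrite compmA. Qed.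

End FunctorCategory.

Program Definition functor_id (C : category) : functor C C :=
  @Functor C C (fun a => a) (fun a b f => f) _ _.
Next Obligation. by []. Qed.
Next Obligation. by []. Qed.

Program Definition functor_comp (B C D : category)
    (G : functor C D) (F : functor B C) : functor B D :=
  @Functor B D (fun a => G (F a)) (fun a b f => fmor G (fmor F f)) _ _.
Next Obligation. by move=> B C D G F a /=; rewrite !fmor1. Qed.
Next Obligation. by move=> B C D G F a b c g f /=; rewrite !fmorM. Qed.

Definition is_iso (C : category) (a b : C) (f : Mor a b) : Prop :=
  exists g : Mor b a, g \oc f = id_mor a /\ f \oc g = id_mor b.

Definition isomorphic (C : category) (a b : C) : Prop :=
  exists f : Mor a b, is_iso f.

Definition equivalent (C D : category) : Prop :=
  exists (F : functor C D) (G : functor D C),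
    @isomorphic (functor_category C C) (functor_comp G F) (functor_id C) /\
    @isomorphic (functor_category D D) (functor_comp F G) (functor_id D).

Definition monomorphism (C : category) (a b : C) (m : Mor a b) : Prop :=
  forall (c : C) (x y : Mor c a), m \oc x = m \oc y -> x = y.

Definition is_pullback (C : category) (a b c p : C)
    (f : Mor a c) (g : Mor b c) (u : Mor p a) (v : Mor p b) : Prop :=
  f \oc u = g \oc v /\
  forall (t : C) (x : Mor t a) (y : Mor t b), f \oc x = g \oc y ->
    exists! h : Mor t p, u \oc h = x /\ v \oc h = y.

Lemma iso1 (C : category) (a : C) : is_iso (id_mor a).
Proof. by exists (id_mor a); rewrite comp1m. Qed.

Lemma isoM (C : category) (a b c : C) (g : Mor b c) (f : Mor a b) :
  is_iso g -> is_iso f -> is_iso (g \oc f).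
Proof.
move=> [g' [g'g gg']] [f' [f'f ff']]; exists (f' \oc g'); split.
  by rewrite -compmA (compmA g') g'g comp1m.
by rewrite -compmA (compmA f) ff' comp1m.
Qed.

Lemma pullback_joint (C : category) (a b c p : C)
    (f : Mor a c) (g : Mor b c) (u : Mor p a) (v : Mor p b) :
  is_pullback f g u v -> forall (t : C) (x y : Mor t p),
  u \oc x = u \oc y -> v \oc x = v \oc y -> x = y.
Proof.
move=> [fg pb] t x y uxy vxy.
have [|h [_ h_uniq]] := pb t (u \oc x) (v \oc x); first by rewrite !compmA fg.
by rewrite -(h_uniq x) // -(h_uniq y).
Qed.

Definition mor_class (C : category) : Type := forall a b : C, Mor a b -> Prop.

Definition orthogonal_to (C : category) (a b c d : C)
    (e : Mor a b) (m : Mor c d) : Prop :=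
  forall (u : Mor a c) (v : Mor b d), m \oc u = v \oc e ->
    exists! w : Mor b c, w \oc e = u /\ m \oc w = v.

Record factorization_system (C : category) (E M : mor_class C) : Prop :=
  FactorizationSystem {
  fs_left : forall (a b : C) (e : Mor a b),
    E a b e <-> forall (c d : C) (m : Mor c d), M c d m -> orthogonal_to e m;
  fs_right : forall (c d : C) (m : Mor c d),
    M c d m <-> forall (a b : C) (e : Mor a b), E a b e -> orthogonal_to e m;
  fs_factor : forall (a b : C) (f : Mor a b),
    exists (c : C) (e : Mor a c) (m : Mor c b), [/\ E a c e, M c b m & m \oc e = f] }.

Section FactorizationTheory.
Variables (C : category) (E M : mor_class C).
Hypothesis fs : factorization_system E M.

Lemma fs_left1 (a : C) : E (id_mor a).
Proof.
apply/(fs_left fs) => c d m _ u v; rewrite compm1 => muv.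
by exists u; split=> [|w []]; rewrite !compm1.
Qed.

Lemma fs_leftM (a b c : C) (g : Mor b c) (f : Mor a b) :
  E g -> E f -> E (g \oc f).
Proof.
move=> Eg Ef; apply/(fs_left fs) => x y m Mm u v; rewrite compmA => muv.
have [w [[wf mw] w_uniq]] := (fs_left fs f).1 Ef x y m Mm u (v \oc g) muv.
have [z [[zg mz] z_uniq]] := (fs_left fs g).1 Eg x y m Mm w v mw.
exists z; split=> [|z' [z'gf mz']]; first by rewrite compmA zg wf.
apply: z_uniq; split=> //; apply/esym/w_uniq; split; first by rewrite -compmA.
by rewrite compmA mz'.
Qed.

Lemma fs_right1 (a : C) : M (id_mor a).
Proof.
apply/(fs_right fs) => x y e _ u v; rewrite comp1m => muv.
by exists v; split=> [|w []]; rewrite !comp1m.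
Qed.

Lemma fs_rightM (a b c : C) (g : Mor b c) (f : Mor a b) :
  M g -> M f -> M (g \oc f).
Proof.
move=> Mg Mf; apply/(fs_right fs) => x y e Ee u v; rewrite -compmA => muv.
have [w [[we gw] w_uniq]] := (fs_right fs g).1 Mg x y e Ee (f \oc u) v muv.
have [z [[ze fz] z_uniq]] := (fs_right fs f).1 Mf x y e Ee u w (esym we).
exists z; split=> [|z' [z'e gfz']]; first by rewrite -compmA fz gw.
apply: z_uniq; split=> //; apply/esym/w_uniq; split; last by rewrite compmA.
by rewrite -compmA z'e.
Qed.

Program Definition left_category : category :=
  @Category C (fun a b => {f : Mor a b | E f})
    (fun a => exist _ (id_mor a) (fs_left1 a))
    (fun a b c g f => exist _ (sval g \oc sval f) (fs_leftM (svalP g) (svalP f)))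
    _ _ _.
Next Obligation. by move=> a b [f Ef]; apply: eq_exist; rewrite /= comp1m. Qed.
Next Obligation. by move=> a b [f Ef]; apply: eq_exist; rewrite /= compm1. Qed.
Next Obligation.
by move=> a b c d [h Eh] [g Eg] [f Ef]; apply: eq_exist; rewrite /= compmA.
Qed.

End FactorizationTheory.

Definition pullback_stable (C : category) (M : mor_class C) : Prop :=
  forall (a b c : C) (f : Mor a c) (m : Mor b c), M b c m ->
    exists (p : C) (u : Mor p a) (v : Mor p b), is_pullback f m u v /\ M p a u.

Record mor_to (C : category) (M : mor_class C) (x : C) : Type := MorTo {
  mt_dom : C;
  mt_mor : Mor mt_dom x;
  mt_in : M mt_dom x mt_mor }.

HB.instance Definition _ (C : category) (M : mor_class C) (x : C) :=
  gen_eqMixin (mor_to M x).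
HB.instance Definition _ (C : category) (M : mor_class C) (x : C) :=
  gen_choiceMixin (mor_to M x).

Section Subobjects.
Variables (C : category) (M : mor_class C) (x : C).

Definition mor_to_iso (m n : mor_to M x) : Prop :=
  exists h : Mor (mt_dom m) (mt_dom n), is_iso h /\ mt_mor n \oc h = mt_mor m.

Definition mor_to_isob : rel (mor_to M x) := fun m n => `[< mor_to_iso m n >].

Lemma mor_to_isob_refl : reflexive mor_to_isob.
Proof.
by move=> m; apply/asboolP; exists (id_mor _); split; [apply: iso1|rewrite compm1].
Qed.

Lemma mor_to_isob_sym : symmetric mor_to_isob.
Proof.
suff H m n : mor_to_isob m n -> mor_to_isob n m by move=> m n; apply/idP/idP => /H.
move=> /asboolP[h [[k [kh hk]] nh]]; apply/asboolP; exists k.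
by split; [exists h|rewrite -nh -compmA hk compm1].
Qed.

Lemma mor_to_isob_trans : transitive mor_to_isob.
Proof.
move=> n m p /asboolP[h [ih nh]] /asboolP[k [ik pk]]; apply/asboolP.
by exists (k \oc h); split; [apply: isoM|rewrite compmA pk].
Qed.

Canonical mor_to_equiv :=
  EquivRel mor_to_isob mor_to_isob_refl mor_to_isob_sym mor_to_isob_trans.

Definition subobject : Type := {eq_quot mor_to_equiv}%qT.

End Subobjects.

Record partial_map (C : category) (M : mor_class C) (x y : C) : Type :=
  PartialMap {
  pm_dom : C;
  pm_left : Mor pm_dom x;
  pm_right : Mor pm_dom y;
  pm_in : M pm_dom x pm_left }.

HB.instance Definition _ (C : category) (M : mor_class C) (x y : C) :=
  gen_eqMixin (partial_map M x y).
HB.instance Definition _ (C : category) (M : mor_class C) (x y : C) :=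
  gen_choiceMixin (partial_map M x y).

Section PartialMapIso.
Variables (C : category) (M : mor_class C) (x y : C).

Definition pm_iso (s t : partial_map M x y) : Prop :=
  exists h : Mor (pm_dom s) (pm_dom t),
    [/\ is_iso h, pm_left t \oc h = pm_left s & pm_right t \oc h = pm_right s].

Definition pm_isob : rel (partial_map M x y) := fun s t => `[< pm_iso s t >].

Lemma pm_isob_refl : reflexive pm_isob.
Proof.
move=> s; apply/asboolP; exists (id_mor _).
by split; [apply: iso1|rewrite compm1|rewrite compm1].
Qed.

Lemma pm_isob_sym : symmetric pm_isob.
Proof.
suff H s t : pm_isob s t -> pm_isob t s by move=> s t; apply/idP/idP => /H.
move=> /asboolP[h [[k [kh hk]] lh rh]]; apply/asboolP; exists k.
by split; [exists h|rewrite -lh -compmA hk compm1|rewrite -rh -compmA hk compm1].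
Qed.

Lemma pm_isob_trans : transitive pm_isob.
Proof.
move=> t s r /asboolP[h [ih lh rh]] /asboolP[k [ik lk rk]]; apply/asboolP.
by exists (k \oc h); split; [apply: isoM|rewrite compmA lk|rewrite compmA rk].
Qed.

Canonical pm_equiv := EquivRel pm_isob pm_isob_refl pm_isob_sym pm_isob_trans.

Definition par_hom : Type := {eq_quot pm_equiv}%qT.

Definition par_class (s : partial_map M x y) : par_hom :=
  (\pi_{eq_quot pm_equiv} s)%qT.

Definition par_repr (c : par_hom) : partial_map M x y :=
  repr (c : {eq_quot pm_equiv}%qT).

Lemma par_reprK (c : par_hom) : par_class (par_repr c) = c.
Proof. exact: reprK. Qed.

Lemma par_classP (s t : partial_map M x y) :
  par_class s = par_class t <-> pm_iso s t.
Proof.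
by split=> [/eqmodP /asboolP //|st]; apply/eqmodP/asboolP.
Qed.

End PartialMapIso.

(** [r] is a composite of the spans [s] and [t], for some choice of pullback. *)
Definition pm_composite (C : category) (M : mor_class C) (x y z : C)
    (t : partial_map M y z) (s : partial_map M x y) (r : partial_map M x z) :
    Prop :=
  exists (u : Mor (pm_dom r) (pm_dom s)) (v : Mor (pm_dom r) (pm_dom t)),
    [/\ is_pullback (pm_right s) (pm_left t) u v,
        pm_left r = pm_left s \oc u & pm_right r = pm_right t \oc v].

Section PartialMapCompositeTheory.
Variables (C : category) (M : mor_class C).

Lemma pm_composite_congr (x y z : C) (t t' : partial_map M y z)
    (s s' : partial_map M x y) (r : partial_map M x z) :
  pm_iso t t' -> pm_iso s s' -> pm_composite t s r -> pm_composite t' s' r.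
Proof.
move=> [k [[k' [k'k kk']] lk rk]] [h [[h' [h'h hh']] lh rh]].
move=> [u [v [[uv pb] lr rr]]].
exists (h \oc u), (k \oc v); rewrite !compmA rk lh.
split=> //; split=> [|T a b ab]; first by rewrite !compmA rh lk.
have [|w [[uw vw] w_uniq]] := pb T (h' \oc a) (k' \oc b).
  by rewrite -rh -lk -!compmA (compmA h) hh' (compmA k) kk' !comp1m.
exists w; split=> [|w' [uw' vw']].
  by rewrite -!compmA uw vw !compmA hh' kk' !comp1m.
by apply: w_uniq; rewrite -uw' -vw' !compmA h'h k'k !comp1m.
Qed.

Lemma pm_composite_uniq (x y z : C) (t : partial_map M y z)
    (s : partial_map M x y) (r r' : partial_map M x z) :
  pm_composite t s r -> pm_composite t s r' -> pm_iso r r'.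
Proof.
move=> [u [v [pb lr rr]]] [u' [v' [pb' lr' rr']]].
have [h [[uh vh] _]] := pb'.2 _ u v pb.1.
have [k [[uk vk] _]] := pb.2 _ u' v' pb'.1.
exists h; rewrite lr lr' rr rr' -!compmA uh vh; split=> //; exists k; split.
  by apply: (pullback_joint pb); rewrite compmA ?uk ?vk ?uh ?vh compm1.
by apply: (pullback_joint pb'); rewrite compmA ?uh ?vh ?uk ?vk compm1.
Qed.

Lemma pm_compositeA (x y z w : C) (t3 : partial_map M z w)
    (t2 : partial_map M y z) (t1 : partial_map M x y)
    (r1 : partial_map M x z) (q : partial_map M y w) (r : partial_map M x w) :
  pm_composite t2 t1 r1 -> pm_composite t3 t2 q -> pm_composite t3 r1 r ->
  pm_composite q t1 r.
Proof.
move=> [a [b [pb1 lr1 rr1]]] [e [f [pbq lq rq]]] [c [d [pbr lr rr]]].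
have [|h [[eh fh] _]] := pbq.2 _ (b \oc c) d.
  by rewrite compmA -rr1; case: pbr.
exists (a \oc c), h; split; last 2 first.
- by rewrite lr lr1 compmA.
- by rewrite rr rq -compmA fh.
split=> [|T u v]; first by rewrite lq -compmA eh !compmA pb1.1.
rewrite lq -compmA => uv.
have [k [[ak bk] _]] := pb1.2 _ _ _ uv.
have [|l [[cl dl] _]] := pbr.2 _ k (f \oc v).
  by rewrite rr1 -compmA bk !compmA pbq.1.
exists l; split=> [|l' [acl' hl']].
  split; first by rewrite -compmA cl.
  by apply: (pullback_joint pbq); rewrite compmA ?eh ?fh // -compmA cl.
apply: (pullback_joint pbr); last by rewrite dl -hl' compmA fh.
rewrite cl; apply: (pullback_joint pb1); first by rewrite ak -acl' compmA.
by rewrite bk -hl' !compmA eh.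
Qed.

End PartialMapCompositeTheory.

Section PartialMapCategory.
Variables (C : category) (E M : mor_class C).
Hypotheses (fs : factorization_system E M) (pb : pullback_stable M).

Lemma pm_composite_ex (x y z : C) (t : partial_map M y z) (s : partial_map M x y) :
  exists r, pm_composite t s r.
Proof.
have [p [u [v [puv Mu]]]] := pb (pm_right s) (pm_in t).
by exists (PartialMap (pm_right t \oc v) (fs_rightM fs (pm_in s) Mu)), u, v.
Qed.

Definition pm_comp (x y z : C) (t : partial_map M y z) (s : partial_map M x y) :
  partial_map M x z := sval (cid (pm_composite_ex t s)).

Lemma pm_compP (x y z : C) (t : partial_map M y z) (s : partial_map M x y) :
  pm_composite t s (pm_comp t s).
Proof. exact: svalP (cid (pm_composite_ex t s)). Qed.

Definition par_comp (x y z : C) (g : par_hom M y z) (f : par_hom M x y) :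
  par_hom M x z := par_class (pm_comp (par_repr g) (par_repr f)).

(** The class of a composite depends neither on the chosen pullback nor on the
    chosen representatives. *)
Lemma par_compP (x y z : C) (t : partial_map M y z) (s : partial_map M x y)
    (r : partial_map M x z) :
  pm_composite t s r -> par_comp (par_class t) (par_class s) = par_class r.
Proof.
move=> ts_r; apply/par_classP; apply: pm_composite_uniq ts_r.
have reprP a b (p : partial_map M a b) : pm_iso (par_repr (par_class p)) p.
  by apply/par_classP/par_reprK.
exact: pm_composite_congr (reprP _ _ _) (reprP _ _ _) (pm_compP _ _).
Qed.

Definition par_id (x : C) : par_hom M x x :=
  par_class (PartialMap (id_mor x) (fs_right1 fs x)).

Program Definition Par : category := @Category C (par_hom M) par_id par_comp _ _ _.
Next Obligation.
move=> x y f; rewrite -(par_reprK f); apply: par_compP.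
exists (id_mor _), (pm_right (par_repr f)) => /=; rewrite compm1 comp1m.
split=> //; split=> [|T a b]; first by rewrite compm1 comp1m.
rewrite comp1m => <-; exists a; split; first by rewrite comp1m.
by move=> a' [<- _]; rewrite comp1m.
Qed.
Next Obligation.
move=> x y f; rewrite -(par_reprK f); apply: par_compP.
exists (pm_left (par_repr f)), (id_mor _) => /=; rewrite compm1 comp1m.
split=> //; split=> [|T a b]; first by rewrite compm1 comp1m.
rewrite comp1m => ->; exists b; split; first by rewrite comp1m.
by move=> b' [_ <-]; rewrite comp1m.
Qed.
Next Obligation.
move=> x y z w h g f.
rewrite -(par_reprK h) -(par_reprK g) -(par_reprK f).
have gf := pm_compP (par_repr g) (par_repr f).
have hg := pm_compP (par_repr h) (par_repr g).
have h_gf := pm_compP (par_repr h) (pm_comp (par_repr g) (par_repr f)).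
rewrite (par_compP gf) (par_compP hg) (par_compP h_gf); apply/esym/par_compP.
exact: pm_compositeA gf hg h_gf.
Qed.

End PartialMapCategory.

(** A category with an abelian group structure on each hom-set; composition is
    only required to be bilinear in [additive_category]. *)
Record zmod_category : Type := ZmodCategory {
  zc_cat :> category;
  zc_zmod : forall a b : zc_cat, GRing.Zmodule (Mor a b) }.

HB.instance Definition _ (X : zmod_category) (a b : X) :
  GRing.Zmodule (Mor a b) := zc_zmod a b.

Record additive_category : Type := AdditiveCategory {
  ac_cat :> zmod_category;
  compmDl : forall (a b c : ac_cat) (g h : Mor b c) (f : Mor a b),
    (g + h)%R \oc f = (g \oc f + h \oc f)%R;
  compmDr : forall (a b c : ac_cat) (h : Mor b c) (f g : Mor a b),
    h \oc (f + g)%R = (h \oc f + h \oc g)%R }.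

(** The case [n = 0] gives a zero object. *)
Definition has_finite_direct_sums (X : additive_category) : Prop :=
  forall (n : nat) (F : 'I_n -> X),
    exists (S : X) (inj : forall k, Mor (F k) S) (proj : forall k, Mor S (F k)),
      [/\ forall k, proj k \oc inj k = id_mor (F k),
          forall k l, k != l -> proj l \oc inj k = 0%R
        & (\sum_(k < n) inj k \oc proj k)%R = id_mor S].

Definition idempotents_split (X : category) : Prop :=
  forall (a : X) (e : Mor a a), e \oc e = e ->
    exists (b : X) (r : Mor a b) (s : Mor b a),
      r \oc s = id_mor b /\ s \oc r = e.

(* Main.v *)
Require Import Defs.
From mathcomp Require Import all_boot all_algebra all_classical.

Set Implicit Arguments.
Unset Strict Implicit.
Unset Printing Implicit Defensive.

Import GRing.Theory.
Local Open Scope classical_set_scope.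
Local Open Scope cat_scope.

(** In [Par A] a subobject [m : u -> x] has a total map [m : u -> x] and a
    partial inverse [m' : x -> u] with [m' m = 1].  A functor [F] on [Par A]
    carries these to idempotents [F m F m'] of [F x], which commute.  Let
    [prim F x] be the image of the product of the complements [1 - F m F m']
    over the proper subobjects.  Since the pullback of a proper subobject along
    a morphism of [E] is proper, [prim F] is a functor on [E].  The maps [F m]
    restricted to [prim F u] present [F x] as a direct sum over all subobjects
    of [x], and a partial map applied to such a summand either vanishes there
    or, when it is total on [u], acts through the [E]-part of its
    factorization.  Hence transformations [F -> F'] are determined by, and
    extend uniquely from, transformations [prim F -> prim F'], and every [G] on
    [E] is [prim] of the functor sending [x] to the direct sum of the [G u]. *)

(** * Isomorphisms of functors and a criterion for equivalence *)

Lemma nattrans_is_iso (C D : category) (F G : functor C D) (t : nattrans F G) :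
  (forall a, is_iso (t a)) -> @is_iso (functor_category C D) F G t.
Proof.
move=> t_iso; pose u a := sval (cid (t_iso a)).
have uP a : u a \oc t a = id_mor _ /\ t a \oc u a = id_mor _.
  exact: svalP (cid (t_iso a)).
have uN a b (f : Mor a b) : u b \oc fmor G f = fmor F f \oc u a.
  rewrite -[LHS]compm1 -(uP a).2 -compmA (compmA (fmor G f)) -ntcN.
  by rewrite !compmA (uP b).1 comp1m.
by exists (NatTrans uN); split; apply: nattransP => a /=; case: (uP a).
Qed.

Lemma full_faithful_ess_surj_equivalent (C D : category) (Phi : functor C D) :
  (forall (a b : C) (g : Mor (Phi a) (Phi b)), exists f, fmor Phi f = g) ->
  (forall (a b : C) (f g : Mor a b), fmor Phi f = fmor Phi g -> f = g) ->
  (forall d : D, exists c, isomorphic (Phi c) d) ->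
  equivalent C D.
Proof.
move=> full faith es.
pose lift a b g := sval (cid (full a b g)).
have liftK a b g : fmor Phi (lift a b g) = g by exact: svalP (cid (full a b g)).
pose o d := sval (cid (es d)).
have oP d : isomorphic (Phi (o d)) d by exact: svalP (cid (es d)).
pose i d : Mor (Phi (o d)) d := sval (cid (oP d)).
have i_iso d : is_iso (i d) by exact: svalP (cid (oP d)).
pose j d : Mor d (Phi (o d)) := sval (cid (i_iso d)).
have jP d : j d \oc i d = id_mor _ /\ i d \oc j d = id_mor _.
  exact: svalP (cid (i_iso d)).
pose Gm a b (g : Mor a b) := lift _ _ (j b \oc g \oc i a).
have G1 a : Gm a a (id_mor a) = id_mor _.
  by apply: faith; rewrite liftK compm1 fmor1 (jP a).1.
have GM a b c (g : Mor b c) (f : Mor a b) : Gm _ _ (g \oc f) = Gm _ _ g \oc Gm _ _ f.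
  apply: faith; rewrite fmorM !liftK -!compmA; congr (_ \oc (_ \oc _)).
  by rewrite !compmA (jP b).2 comp1m.
pose G := Functor G1 GM.
exists Phi, G; split.
  have tN a b (f : Mor a b) : lift _ _ (i (Phi b)) \oc fmor (functor_comp G Phi) f
      = fmor (functor_id C) f \oc lift _ _ (i (Phi a)).
    apply: faith; rewrite !fmorM !liftK /= !compmA (jP _).2 comp1m.
    by [].
  exists (@NatTrans C C (functor_comp G Phi) (functor_id C) _ tN).
  apply: nattrans_is_iso => a /=.
  exists (lift _ _ (j (Phi a))).
  by split; apply: faith; rewrite fmorM !liftK fmor1; case: (jP (Phi a)).
have tN a b (f : Mor a b) : i b \oc fmor (functor_comp Phi G) f
      = fmor (functor_id D) f \oc i a.
  by rewrite /= liftK !compmA (jP b).2 comp1m.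
exists (@NatTrans D D (functor_comp Phi G) (functor_id D) _ tN).
exact: nattrans_is_iso.
Qed.

(** * Additive categories: bilinearity and complements of commuting idempotents *)

Section Additive.
Variable X : additive_category.

Lemma comp0m (a b c : X) (f : Mor a b) : (0%R : Mor b c) \oc f = 0%R.
Proof. by apply: (addIr ((0%R : Mor b c) \oc f)); rewrite -compmDl !add0r. Qed.

Lemma compm0 (a b c : X) (g : Mor b c) : g \oc (0%R : Mor a b) = 0%R.
Proof. by apply: (addIr (g \oc (0%R : Mor a b))); rewrite -compmDr !add0r. Qed.

Lemma compmBl (a b c : X) (g h : Mor b c) (f : Mor a b) :
  (g - h)%R \oc f = (g \oc f - h \oc f)%R.
Proof. by apply/eqP; rewrite eq_sym subr_eq -compmDl subrK. Qed.

Lemma compmBr (a b c : X) (h : Mor b c) (f g : Mor a b) :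
  h \oc (f - g)%R = (h \oc f - h \oc g)%R.
Proof. by apply/eqP; rewrite eq_sym subr_eq -compmDr subrK. Qed.

Lemma compm_suml (I : finType) (a b c : X) (g : I -> Mor b c) (f : Mor a b) :
  (\sum_i g i)%R \oc f = (\sum_i g i \oc f)%R.
Proof. by elim/big_ind2: _ => [|? ? ? ? <- <-|//]; rewrite ?comp0m ?compmDl. Qed.

Lemma compm_sumr (I : finType) (a b c : X) (h : Mor b c) (f : I -> Mor a b) :
  h \oc (\sum_i f i)%R = (\sum_i h \oc f i)%R.
Proof. by elim/big_ind2: _ => [|? ? ? ? <- <-|//]; rewrite ?compm0 ?compmDr. Qed.

(** The witness is the product of the [id_mor a - q i]. The last two clauses make it the identity on
    the joint kernel of the [q i], and dually; taking [z := p] also gives idempotence. *)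
Lemma commuting_idempotents_complement (a : X) (n : nat) (q : 'I_n -> Mor a a) :
  (forall i, q i \oc q i = q i) ->
  (forall i j, q i \oc q j = q j \oc q i) ->
  exists p : Mor a a,
    [/\ forall i, q i \oc p = 0%R, forall i, p \oc q i = 0%R,
        forall (w : X) (z : Mor w a), (forall i, q i \oc z = 0%R) -> p \oc z = z
      & forall (w : X) (y : Mor a w), (forall i, y \oc q i = 0%R) -> y \oc p = y].
Proof.
move=> qq qC.
(* Only the factors already listed are annihilated; commutation with every [q i] is carried along to
   turn left annihilation into right annihilation at the end. *)
suff [p [p0 pC pz yp]] : exists p : Mor a a,
    [/\ forall i, i \in enum 'I_n -> q i \oc p = 0%R,
        forall i, q i \oc p = p \oc q i,
        forall (w : X) (z : Mor w a), (forall i, q i \oc z = 0%R) -> p \oc z = z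
      & forall (w : X) (y : Mor a w), (forall i, y \oc q i = 0%R) -> y \oc p = y].
  by exists p; split=> // i; rewrite -?pC p0 ?mem_enum.
elim: (enum _) => [|k s [p [p0 pC pz yp]]].
  by exists (id_mor a); split=> *; rewrite ?comp1m ?compm1.
exists ((id_mor a - q k)%R \oc p); split=> [i|i|w z z0|w y y0].
- rewrite compmA compmBr compm1 inE => /predU1P[->|/p0 ip].
    by rewrite qq subrr comp0m.
  by rewrite compmBl ip qC -compmA ip compm0 subr0.
- rewrite compmA compmBr compm1 qC -[in RHS]compmA -pC compmA.
  by rewrite [in RHS]compmBl comp1m.
- by rewrite -compmA pz // compmBl comp1m z0 subr0.
by rewrite compmA compmBr compm1 y0 subr0 yp.
Qed.

End Additive.

(** * Monomorphisms, pullbacks and the factorization system *)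

Lemma split_epi_mono_iso (C : category) (a b : C) (m : Mor a b) (k : Mor b a) :
  monomorphism m -> m \oc k = id_mor b -> is_iso m.
Proof.
by move=> mm mk; exists k; split=> //; apply: mm; rewrite compmA mk comp1m compm1.
Qed.

Lemma is_pullback_sym (C : category) (a b c p : C)
    (f : Mor a c) (g : Mor b c) (u : Mor p a) (v : Mor p b) :
  is_pullback f g u v -> is_pullback g f v u.
Proof.
move=> [fg pb]; split=> // t x y /esym /pb[h [[uh vh] h_uniq]].
by exists h; split=> // h' [vh' uh']; apply: h_uniq.
Qed.

Section Factorization.
Variables (A : category) (E M : mor_class A) (fs : factorization_system E M).
Hypothesis mono : forall (a b : A) (m : Mor a b), M m -> monomorphism m.

Lemma iso_left (a b : A) (f : Mor a b) : is_iso f -> E f.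
Proof.
move=> [g [gf fg]]; apply/(fs_left fs) => c d m _ u v muv.
exists (u \oc g); split=> [|w [<- _]]; last by rewrite -compmA fg compm1.
by rewrite -compmA gf compm1 compmA muv -compmA fg compm1.
Qed.

Lemma right_cancel (a b c : A) (m : Mor b c) (g : Mor a b) :
  M m -> M (m \oc g) -> M g.
Proof.
move=> Mm Mmg; apply/(fs_right fs) => x y e Ee u v guv.
have [|w [[we mgw] w_uniq]] := (fs_right fs _).1 Mmg x y e Ee u (m \oc v).
  by rewrite -!compmA guv.
exists w; split=> [|w' [w'e gw']].
  by split=> //; apply: (mono Mm); rewrite compmA.
by apply: w_uniq; rewrite -compmA gw'.
Qed.

(** The square from [e] to [m] with top [k] and bottom the identity has a filler, which is a section
    of the monomorphism [m]. *)
Lemma left_factor_iso (a b c : A) (e : Mor a b) (m : Mor c b) (k : Mor a c) :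
  E e -> M m -> m \oc k = e -> is_iso m.
Proof.
move=> Ee Mm mk.
have [|w [[_ mw] _]] := (fs_left fs e).1 Ee _ _ m Mm k (id_mor b).
  by rewrite comp1m.
exact: split_epi_mono_iso (mono Mm) mw.
Qed.

Definition sub_comp (x : A) (m : mor_to M x) (k : mor_to M (mt_dom m)) : mor_to M x :=
  MorTo (fs_rightM fs (mt_in m) (mt_in k)).

Lemma sub_comp_iso (x : A) (m : mor_to M x) (k : mor_to M (mt_dom m)) :
  is_iso (mt_mor (sub_comp k)) -> is_iso (mt_mor m).
Proof.
move=> [h [_ mkh]]; apply: (@split_epi_mono_iso _ _ _ _ (mt_mor k \oc h)).
  exact: mono (mt_in m).
by rewrite compmA.
Qed.

(** * Total maps and restrictions to subobjects in [Par] *)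

Hypothesis pb : pullback_stable M.

Notation P := (Par fs pb).

Definition tot (x y : A) (f : Mor x y) : @Mor P x y :=
  par_class (PartialMap f (fs_right1 fs x)).

Definition restr (x : A) (m : mor_to M x) : @Mor P x (mt_dom m) :=
  par_class (PartialMap (id_mor _) (mt_in m)).

Lemma totM (x y z : A) (g : Mor y z) (f : Mor x y) :
  tot (g \oc f) = tot g \oc tot f.
Proof.
apply/esym/par_compP; exists (id_mor _), f => /=; rewrite compm1.
split=> //; split=> [|T a b]; first by rewrite compm1 comp1m.
rewrite comp1m => <-; exists a; split; first by rewrite comp1m.
by move=> a' [<- _]; rewrite comp1m.
Qed.

Lemma restrM (x : A) (m : mor_to M x) (k : mor_to M (mt_dom m)) :
  restr (sub_comp k) = restr k \oc restr m.
Proof.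
apply/esym/par_compP; exists (mt_mor k), (id_mor _) => /=; rewrite compm1.
split=> //; split=> [|T a b]; first by rewrite compm1 comp1m.
rewrite comp1m => ->; exists b; split; first by rewrite comp1m.
by move=> b' [_ <-]; rewrite comp1m.
Qed.

Lemma tot_restrE (x y : A) (m : mor_to M x) (f : Mor (mt_dom m) y) :
  tot f \oc restr m = par_class (PartialMap f (mt_in m)).
Proof.
apply: par_compP; exists (id_mor _), (id_mor _); rewrite /= !compm1.
split=> //; split=> // T a b; rewrite !comp1m => <-; exists a.
by split=> [|a' []]; rewrite !comp1m.
Qed.

Lemma restr_tot (x y : A) (f : Mor x y) (m : mor_to M y) (n : mor_to M x)
    (g : Mor (mt_dom n) (mt_dom m)) :
  is_pullback f (mt_mor m) (mt_mor n) g -> restr m \oc tot f = tot g \oc restr n.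
Proof.
by move=> fmng; rewrite tot_restrE; apply: par_compP; exists (mt_mor n), g; rewrite !comp1m.
Qed.

Lemma restr_tot_ex (x y : A) (f : Mor x y) (m : mor_to M y) :
  exists (n : mor_to M x) (g : Mor (mt_dom n) (mt_dom m)),
    is_pullback f (mt_mor m) (mt_mor n) g /\ restr m \oc tot f = tot g \oc restr n.
Proof.
have [p [u [v [fm Mu]]]] := pb f (mt_in m).
by exists (MorTo Mu), v; split=> //; apply: restr_tot.
Qed.

Lemma restr_sub (x : A) (m : mor_to M x) : restr m \oc tot (mt_mor m) = id_mor (mt_dom m : P).
Proof.
rewrite (@restr_tot _ _ _ m (MorTo (fs_right1 fs _)) (id_mor _)) ?tot_restrE //.
split=> // t a b /(mono (mt_in m)) <-; exists a.
by split=> [|a' []]; rewrite !comp1m.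
Qed.

Lemma tot_restr_ex (x y : A) (phi : @Mor P x y) :
  exists (m : mor_to M x) (f : Mor (mt_dom m) y), phi = tot f \oc restr m.
Proof.
exists (MorTo (pm_in (par_repr phi))), (pm_right (par_repr phi)).
by rewrite tot_restrE -[LHS]par_reprK; case: (par_repr phi).
Qed.

Lemma tot_inj (x y : A) (f g : Mor x y) : tot f = tot g -> f = g.
Proof.
by move=> /par_classP[h [_ /=]]; rewrite comp1m => ->; rewrite compm1.
Qed.

Lemma tot_restr_tot_iso (x y : A) (m : mor_to M x) (f : Mor (mt_dom m) y) (g : Mor x y) :
  tot f \oc restr m = tot g -> is_iso (mt_mor m).
Proof. by rewrite tot_restrE => /par_classP[h [hi /=]]; rewrite comp1m => <-. Qed.

Lemma restr_iso (x : A) (m : mor_to M x) (h : Mor x (mt_dom m)) :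
  mt_mor m \oc h = id_mor x -> restr m = tot h.
Proof.
move=> mh; rewrite -[LHS]compm1 -[id_mor _]/(tot (id_mor x)) -mh totM.
by rewrite compmA restr_sub comp1m.
Qed.

Lemma partial_or_total (x y : A) (phi : @Mor P x y) :
  (exists f, phi = tot f) \/
  (exists (m : mor_to M x) (f : Mor (mt_dom m) y),
     ~ is_iso (mt_mor m) /\ phi = tot f \oc restr m).
Proof.
have [m [f ->]] := tot_restr_ex phi.
have [[h [_ mh]]|mN] := pselect (is_iso (mt_mor m)); last by right; exists m, f.
by left; exists (f \oc h); rewrite (restr_iso mh) totM.
Qed.

(** A composite is defined only inside the domain of [phi], so it cannot be total when that domain
    is proper. *)
Lemma total_comp_right (x y z : A) (psi : @Mor P y z) (phi : @Mor P x y) (f : Mor x z) :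
  psi \oc phi = tot f -> exists g, phi = tot g.
Proof.
have [//|[m [g [mN ->]]]] := partial_or_total phi.
have [n [h ->]] := tot_restr_ex psi; have [k [g' [_ ngk]]] := restr_tot_ex g n.
rewrite compmA -(compmA (tot h)) ngk compmA -totM -compmA -restrM.
by move=> /(@tot_restr_tot_iso _ _ (sub_comp k)) /sub_comp_iso.
Qed.

(** If the domain [m] of [psi] pulls back along [e] to the whole of [x], then [e] factors through
    [m], which forces [m] to be invertible. *)
Lemma total_comp_left (x y z : A) (psi : @Mor P y z) (e : Mor x y) (f : Mor x z) :
  E e -> psi \oc tot e = tot f -> exists g, psi = tot g.
Proof.
move=> Ee; have [//|[m [g [mN ->]]]] := partial_or_total psi.
have [k [h [kP meq]]] := restr_tot_ex e m.
rewrite -compmA meq compmA -totM => /tot_restr_tot_iso[k' [_ kk']].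
case: mN; apply: (left_factor_iso (k := h \oc k') Ee (mt_in m)).
by rewrite compmA -kP.1 -compmA kk' compm1.
Qed.

Lemma restr_left (x y : A) (e : Mor x y) (m : mor_to M y) :
  E e -> ~ is_iso (mt_mor m) ->
  exists (n : mor_to M x) (g : Mor (mt_dom n) (mt_dom m)),
    ~ is_iso (mt_mor n) /\ restr m \oc tot e = tot g \oc restr n.
Proof.
move=> Ee mN; have [n [g [nP ne]]] := restr_tot_ex e m; exists n, g; split=> //.
move=> [n' [_ nn']]; apply: mN; apply: (left_factor_iso (k := g \oc n') Ee (mt_in m)).
by rewrite compmA -nP.1 -compmA nn' compm1.
Qed.

Lemma restr_eq (x u : A) (m m' : Mor u x) (Mm : M m) (Mm' : M m') :
  m = m' -> restr (MorTo Mm) = restr (MorTo Mm').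
Proof. by move=> mm'; subst m'; congr (restr (MorTo _)); apply: Prop_irrelevance. Qed.

(** Both sides are the idempotent of the intersection of [m] and [n], computed by one pullback
    square read in its two directions. *)
Lemma restr_idem_comm (x : A) (m n : mor_to M x) :
  tot (mt_mor m) \oc restr m \oc (tot (mt_mor n) \oc restr n)
  = tot (mt_mor n) \oc restr n \oc (tot (mt_mor m) \oc restr m).
Proof.
have [k [g [kP nk]]] := restr_tot_ex (mt_mor n) m.
(* By cancellation the second projection is in [M] too, so the transposed square computes the other
   composite. *)
have Mg : M g.
  by apply: (right_cancel (mt_in m)); rewrite -kP.1; apply: (fs_rightM fs (mt_in n) (mt_in k)).
have mg : restr n \oc tot (mt_mor m) = tot (mt_mor k) \oc restr (MorTo Mg).
  exact: (@restr_tot _ _ _ n (MorTo Mg) (mt_mor k) (is_pullback_sym kP)).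
rewrite !compmA -(compmA _ (restr m)) nk -(compmA _ (restr n) (tot (mt_mor m))) mg.
rewrite !compmA -!totM -kP.1 -!compmA.
rewrite -(restrM (m := n) k) -(restrM (m := m) (MorTo Mg)); congr (_ \oc _).
exact: restr_eq kP.1.
Qed.

(** The cases are: [m] and [n] are the same subobject, [m] is not contained in [n], [m] is properly
    contained in [n]. The last two are the reasons why summands for different subobjects are
    orthogonal. *)
Lemma restr_sub_cases (x : A) (m n : mor_to M x) :
  [\/ exists h : Mor (mt_dom m) (mt_dom n),
        is_iso h /\ mt_mor n \oc h = mt_mor m,
      exists (k : mor_to M (mt_dom m)) (g : Mor (mt_dom k) (mt_dom n)),
        ~ is_iso (mt_mor k) /\ restr n \oc tot (mt_mor m) = tot g \oc restr k
    | exists k : mor_to M (mt_dom n), exists p : @Mor P (mt_dom m) (mt_dom k),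
        ~ is_iso (mt_mor k) /\ restr n \oc tot (mt_mor m) = tot (mt_mor k) \oc p].
Proof.
have [k [g [kP nm]]] := restr_tot_ex (mt_mor m) n.
have [[k' [k'k kk']]|kN] := pselect (is_iso (mt_mor k)); last first.
  by apply: Or32; exists k, g.
have ng : mt_mor n \oc (g \oc k') = mt_mor m by rewrite compmA -kP.1 -compmA kk' compm1.
have Mg : M (g \oc k').
  by apply: (right_cancel (mt_in n)); rewrite ng; apply: mt_in.
have [gi|gN] := pselect (is_iso (g \oc k')); first by apply: Or31; exists (g \oc k').
apply: Or33; exists (MorTo Mg), (tot (id_mor _)).
by split=> //; rewrite nm (restr_iso kk') -!totM compm1.
Qed.

Lemma subobject_transversal (x : A) : finite_set [set: subobject M x] ->
  exists (n : nat) (c : 'I_n -> mor_to M x),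
    (forall m, exists i, mor_to_iso m (c i)) /\
    (forall i j, mor_to_iso (c i) (c j) -> i = j).
Proof.
move=> /(@finite_seqP {eq_quot mor_to_equiv M x}%qT)[s sP].
exists (size (undup s)), (fun i => repr (tnth (in_tuple (undup s)) i)); split=> [m|i j ij].
  have : (\pi_({eq_quot mor_to_equiv M x}) m)%qT \in undup s.
    rewrite mem_undup; have : [set: {eq_quot mor_to_equiv M x}%qT] (\pi m)%qT by [].
    by rewrite sP.
  rewrite -[undup s]/(in_tuple (undup s) : seq _) => /tnthP[i mi]; exists i.
  by rewrite -mi; apply/asboolP/(@eqmodP _ (mor_to_equiv M x)); rewrite reprK.
apply: (tuple_uniqP (in_tuple (undup s)) (undup_uniq s)); rewrite -[LHS]reprK -[RHS]reprK.
by apply/(@eqmodP _ (mor_to_equiv M x))/asboolP.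
Qed.


Lemma restr_mor_to_iso (x : A) (m n : mor_to M x) (h : Mor (mt_dom m) (mt_dom n)) :
  is_iso h -> mt_mor n \oc h = mt_mor m -> restr n = tot h \oc restr m.
Proof.
move=> [h' [h'h hh']] nh; rewrite tot_restrE; apply/par_classP; exists h' => /=.
by split=> //; [exists h|rewrite -nh -compmA hh' compm1].
Qed.

(** * The primitive part of a functor on [Par] *)

Variable X : additive_category.
Notation L := (left_category fs).

Section Core.
Variable F : functor P X.

Definition primitive (x : A) (W : X) (z : Mor W (F x)) : Prop :=
  forall m : mor_to M x, ~ is_iso (mt_mor m) -> fmor F (restr m) \oc z = 0%R.

Definition coprimitive (x : A) (W : X) (y : Mor (F x) W) : Prop :=
  forall m : mor_to M x, ~ is_iso (mt_mor m) -> y \oc fmor F (tot (mt_mor m)) = 0%R.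

(** A splitting of the idempotent of [F x] whose image is the joint kernel of
    the restrictions to proper subobjects and whose kernel is the joint image
    of the inclusions of proper subobjects. *)
Record core (x : A) : Type := Core {
  core_ob : X;
  core_in : Mor core_ob (F x);
  core_out : Mor (F x) core_ob;
  core_inK : core_out \oc core_in = id_mor core_ob;
  core_in_primitive : primitive core_in;
  core_out_coprimitive : coprimitive core_out;
  core_primitive : forall (W : X) (z : Mor W (F x)),
    primitive z -> core_in \oc (core_out \oc z) = z;
  core_coprimitive : forall (W : X) (y : Mor (F x) W),
    coprimitive y -> y \oc core_in \oc core_out = y }.

Lemma fmor_restr_sub (x : A) (m : mor_to M x) :
  fmor F (restr m) \oc fmor F (tot (mt_mor m)) = id_mor (F (mt_dom m)).
Proof. by rewrite -fmorM restr_sub fmor1. Qed.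

Hypothesis fin : forall x : A, finite_set [set: subobject M x].
Hypothesis splits : idempotents_split X.

Lemma core_inhabited (x : A) : inhabited (core x).
Proof.
have [n [c [c_surj _]]] := subobject_transversal (fin x).
(* A representative of the whole object gets [0], whose complement is the identity, so only proper
   subobjects contribute. *)
pose q i : Mor (F x) (F x) := if `[< is_iso (mt_mor (c i)) >] then 0%R
  else fmor F (tot (mt_mor (c i))) \oc fmor F (restr (c i)).
have qq i : q i \oc q i = q i.
  rewrite /q; case: ifP => _; first by rewrite comp0m.
  by rewrite compmA -(compmA _ (fmor F (restr _))) fmor_restr_sub compm1.
have qC i j : q i \oc q j = q j \oc q i.
  rewrite /q; case: ifP => _; first by rewrite comp0m compm0.
  by case: ifP => _; rewrite ?comp0m ?compm0 // -!fmorM restr_idem_comm.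
(* For proper [c i], [fmor F (tot _)] is a split monomorphism, so [q i] kills [z] exactly when the
   restriction to [c i] does; every proper [m] is isomorphic to such a [c i]. *)
have qprim (W : X) (z : Mor W (F x)) : primitive z <-> forall i, q i \oc z = 0%R.
  split=> [zP i|zq m mN].
    rewrite /q; case: ifPn => [_|/asboolPn iN]; first by rewrite comp0m.
    by rewrite -compmA zP ?compm0.
  have [i [h [[h' [h'h hh']] cm]]] := c_surj m.
  have ciN : ~ is_iso (mt_mor (c i)).
    by move=> ci; apply: mN; rewrite -cm; apply: isoM => //; exists h'.
  rewrite (restr_mor_to_iso (m := c i) (h := h')).
  - move: (zq i); rewrite /q asboolF // => qz.
    rewrite fmorM -compmA -[fmor F (restr _)]comp1m -(fmor_restr_sub (c i)).
    by rewrite -!compmA (compmA _ _ z) qz !compm0.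
  - by exists h.
  by rewrite -cm -compmA hh' compm1.
(* Dually, [fmor F (restr _)] is a split epimorphism. *)
have qcoprim (W : X) (y : Mor (F x) W) :
    coprimitive y <-> forall i, y \oc q i = 0%R.
  split=> [yP i|yq m mN].
    rewrite /q; case: ifPn => [_|/asboolPn iN]; first by rewrite compm0.
    by rewrite compmA yP ?comp0m.
  have [i [h [[h' [h'h hh']] cm]]] := c_surj m.
  have ciN : ~ is_iso (mt_mor (c i)).
    by move=> ci; apply: mN; rewrite -cm; apply: isoM => //; exists h'.
  move: (yq i); rewrite /q asboolF // => qy.
  rewrite -cm totM fmorM -[fmor F (tot (mt_mor _))]compm1 -(fmor_restr_sub (c i)).
  by rewrite !compmA -(compmA y) qy !comp0m.
have [p [qp pq pz yp]] := commuting_idempotents_complement qq qC.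
have pp : p \oc p = p by exact: pz.
have [b [r [s [rs sr]]]] := splits pp.
have ps : p \oc s = s by rewrite -sr -compmA rs compm1.
have rp : r \oc p = r by rewrite -sr compmA rs comp1m.
constructor; apply: (@Core x b s r) => //.
- by apply/qprim => i; rewrite -ps compmA qp comp0m.
- by apply/qcoprim => i; rewrite -rp -compmA pq compm0.
- by move=> W z /qprim /pz; rewrite compmA sr.
by move=> W y /qcoprim /yp; rewrite -compmA sr.
Qed.

Definition core_at (x : A) : core x := inhabited_witness (core_inhabited x).

Definition prim_ob (x : A) : X := core_ob (core_at x).
Definition prim_in (x : A) : Mor (prim_ob x) (F x) := core_in (core_at x).
Definition prim_out (x : A) : Mor (F x) (prim_ob x) := core_out (core_at x).

Lemma prim_inK (x : A) : prim_out x \oc prim_in x = id_mor (prim_ob x).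
Proof. exact: core_inK. Qed.

Lemma primitiveK (x : A) (W : X) (z : Mor W (F x)) :
  primitive z -> prim_in x \oc (prim_out x \oc z) = z.
Proof. exact: core_primitive. Qed.

Lemma coprimitiveK (x : A) (W : X) (y : Mor (F x) W) :
  coprimitive y -> y \oc prim_in x \oc prim_out x = y.
Proof. exact: core_coprimitive. Qed.

Lemma primitive_left (x y : A) (e : Mor x y) (W : X) (z : Mor W (F x)) :
  E e -> primitive z -> primitive (fmor F (tot e) \oc z).
Proof.
move=> Ee zP m mN; have [n [g [nN me]]] := restr_left Ee mN.
by rewrite compmA -fmorM me fmorM -compmA zP ?compm0.
Qed.

Definition prim_mor (x y : A) (e : @Mor L x y) : Mor (prim_ob x) (prim_ob y) :=
  prim_out y \oc (fmor F (tot (sval e)) \oc prim_in x).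

(** [fmor F (tot (sval e))] preserves primitive maps, so the projection [prim_out y] in [prim_mor]
    loses nothing. Functoriality of [prim_mor] rests on this. *)
Lemma prim_in_nat (x y : A) (e : @Mor L x y) :
  prim_in y \oc prim_mor e = fmor F (tot (sval e)) \oc prim_in x.
Proof.
by apply: primitiveK; apply: primitive_left (svalP e) _; apply: core_in_primitive.
Qed.

Lemma prim_mor1 (x : L) : prim_mor (id_mor x) = id_mor (prim_ob x).
Proof. by rewrite /prim_mor /= (fmor1 F) comp1m prim_inK. Qed.

Lemma prim_morM (x y z : L) (g : Mor y z) (f : Mor x y) :
  prim_mor (g \oc f) = prim_mor g \oc prim_mor f.
Proof.
by rewrite {2}/prim_mor -!compmA prim_in_nat {1}/prim_mor /= totM fmorM -!compmA.
Qed.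

Definition prim : functor L X := Functor prim_mor1 prim_morM.

(** Induction from small subobjects upwards: if [y] vanishes on all proper subobjects of [m], then
    [y \oc fmor F (tot (mt_mor m))] is coprimitive, hence determined by its restriction to the
    primitive part, where it is zero. *)
Lemma prim_joint_epi (x : A) (W : X) (y : Mor (F x) W) :
  (forall m : mor_to M x, y \oc (fmor F (tot (mt_mor m)) \oc prim_in (mt_dom m)) = 0%R) ->
  y = 0%R.
Proof.
move=> y0; have [n [c [c_surj _]]] := subobject_transversal (fin x).
(* The induction measure counts the representatives that factor through [m]. *)
pose below (m : mor_to M x) :=
  [set i | `[< exists h, mt_mor m \oc h = mt_mor (c i) >] ]%SET.
suff main k (m : mor_to M x) : #|below m| < k -> y \oc fmor F (tot (mt_mor m)) = 0%R.
  have := main _ (MorTo (fs_right1 fs x)) (ltnSn _).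
  by rewrite (fmor1 F) compm1.
elim: k m => // k IHk m; rewrite ltnS => mk.
rewrite -[LHS]coprimitiveK; first by rewrite -(compmA y) y0 comp0m.
move=> l lN; rewrite -compmA -fmorM -totM; apply: (IHk (sub_comp l)).
apply: leq_trans mk; apply: proper_card; apply/properP; split.
  apply/fintype.subsetP => i; rewrite !inE => -[h mlh].
  by exists (mt_mor l \oc h); rewrite compmA.
(* The representative of [m] itself factors through [m] but not through the proper subobject [l] of
   it, so the count drops. *)
have [i [h [[h' [h'h hh']] cm]]] := c_surj m.
exists i; rewrite inE.
  by apply/asboolP; exists h'; rewrite -cm -compmA hh' compm1.
apply/asboolP => -[g mlg]; apply: lN.
apply: (@split_epi_mono_iso _ _ _ _ (g \oc h)); first exact: mono (mt_in l).
by apply: (mono (mt_in m)); rewrite !compmA mlg cm compm1.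
Qed.

Lemma prim_joint_epi_eq (x : A) (W : X) (y y' : Mor (F x) W) :
  (forall m : mor_to M x, y \oc (fmor F (tot (mt_mor m)) \oc prim_in (mt_dom m))
     = y' \oc (fmor F (tot (mt_mor m)) \oc prim_in (mt_dom m))) ->
  y = y'.
Proof.
move=> yy'; apply/eqP; rewrite -subr_eq0; apply/eqP/prim_joint_epi => m.
by rewrite compmBl yy' subrr.
Qed.

(** The map [restr n \oc tot (mt_mor m)] either starts with a proper restriction, which kills
    [prim_in], or ends with a proper inclusion, which [prim_out] kills. *)
Lemma prim_orthogonal (x : A) (m n : mor_to M x) : ~ mor_to_iso m n ->
  prim_out (mt_dom n) \oc fmor F (restr n) \oc
    (fmor F (tot (mt_mor m)) \oc prim_in (mt_dom m)) = 0%R.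
Proof.
move=> mn; rewrite -compmA (compmA (fmor F (restr n))) -fmorM.
have [//|[k [g [kN ->]]]|[k [p [kN ->]]]] := restr_sub_cases m n.
  by rewrite fmorM -compmA core_in_primitive ?compm0.
by rewrite fmorM !compmA core_out_coprimitive ?comp0m.
Qed.

Lemma prim_out_in (x : A) (m : mor_to M x) :
  prim_out (mt_dom m) \oc fmor F (restr m) \oc
    (fmor F (tot (mt_mor m)) \oc prim_in (mt_dom m)) = id_mor _.
Proof.
by rewrite -compmA (compmA (fmor F (restr m))) fmor_restr_sub comp1m prim_inK.
Qed.

End Core.

(** * The functor [prim_functor] is full and faithful *)

Section Equivalence.
Hypothesis fin : forall x : A, finite_set [set: subobject M x].
Hypothesis splits : idempotents_split X.
Notation prim := (fun F => prim F fin splits).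
Notation pin F := (prim_in F fin splits).
Notation pout F := (prim_out F fin splits).

Lemma primitive_nat (F G : functor P X) (t : nattrans F G) (x : A) (W : X)
    (z : Mor W (F x)) : primitive z -> primitive (t x \oc z).
Proof. by move=> zP m mN; rewrite compmA -ntcN -compmA zP ?compm0. Qed.

Definition prim_nat (F G : functor P X) (t : nattrans F G) (x : A) :
  Mor (prim F x) (prim G x) := pout G x \oc (t x \oc pin F x).

Lemma prim_in_natural (F G : functor P X) (t : nattrans F G) (x : A) :
  pin G x \oc prim_nat t x = t x \oc pin F x.
Proof. by apply: primitiveK; apply: primitive_nat; apply: core_in_primitive. Qed.

Lemma prim_natN (F G : functor P X) (t : nattrans F G) (x y : L) (e : Mor x y) :
  prim_nat t y \oc fmor (prim F) e = fmor (prim G) e \oc prim_nat t x.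
Proof.
rewrite {1}/prim_nat /= -!compmA prim_in_nat prim_in_natural.
by rewrite (compmA (t y)) ntcN -compmA.
Qed.

Program Definition prim_functor :
    functor (functor_category P X) (functor_category L X) :=
  @Functor (functor_category P X) (functor_category L X) prim
    (fun F G t => NatTrans (@prim_natN F G t)) _ _.
Next Obligation.
by move=> F; apply: nattransP => x; rewrite /= /prim_nat /= comp1m prim_inK.
Qed.
Next Obligation.
move=> F G H u t; apply: nattransP => x /=.
by rewrite {2}/prim_nat -!compmA prim_in_natural {1}/prim_nat /= -!compmA.
Qed.

(** Naturality along [tot (mt_mor m)] expresses a transformation on each summand through its
    primitive part, and the summands are jointly epic. *)
Lemma prim_functor_faithful (F G : functor P X) (s t : nattrans F G) :
  fmor prim_functor s = fmor prim_functor t -> s = t.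
Proof.
move=> st; apply: nattransP => x; apply: prim_joint_epi_eq => m.
have {}st : prim_nat s (mt_dom m) = prim_nat t (mt_dom m) by case: st => /(congr1 (@^~ _)).
by rewrite !compmA !ntcN -!compmA -!prim_in_natural st.
Qed.

Lemma prim_in_factor (F : functor P X) (x y : A) (m : mor_to M y)
    (e : @Mor L x (mt_dom m)) (f : Mor x y) : mt_mor m \oc sval e = f ->
  fmor F (tot f) \oc pin F x
  = fmor F (tot (mt_mor m)) \oc pin F (mt_dom m) \oc fmor (prim F) e.
Proof. by move=> <-; rewrite totM fmorM -!compmA prim_in_nat. Qed.

Lemma prim_functor_full (F G : functor P X) (a : nattrans (prim F) (prim G)) :
  exists t : nattrans F G, fmor prim_functor t = a.
Proof.
pose inF (x : A) (m : mor_to M x) := fmor F (tot (mt_mor m)) \oc pin F (mt_dom m).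
pose inG (x : A) (m : mor_to M x) := fmor G (tot (mt_mor m)) \oc pin G (mt_dom m).
have [t tP] : exists t : forall x : A, Mor (F x) (G x),
    forall x (m : mor_to M x), t x \oc inF x m = inG x m \oc a (mt_dom m).
  suff ex x : exists t : Mor (F x) (G x),
      forall m : mor_to M x, t \oc inF x m = inG x m \oc a (mt_dom m).
    by exists (fun x => sval (cid (ex x))) => x; apply: svalP (cid (ex x)).
  have [n [c [c_surj c_inj]]] := subobject_transversal (fin x).
  (* The maps [pout \oc fmor F (restr _)] are the projections onto the summands; by orthogonality
     only the term of index [i] survives on the summand of [c i]. *)
  pose t := (\sum_(i < n) inG x (c i) \oc a (mt_dom (c i)) \oc
              (pout F (mt_dom (c i)) \oc fmor F (restr (c i))))%R.
  have tc i : t \oc inF x (c i) = inG x (c i) \oc a (mt_dom (c i)).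
    rewrite compm_suml (bigD1 i) //= big1 => [|j ji].
      by rewrite addr0 -[LHS]compmA prim_out_in compm1.
    rewrite -[LHS]compmA prim_orthogonal ?compm0 // => /c_inj ij.
    by rewrite ij eqxx in ji.
  exists t => m; have [i [h [hi cm]]] := c_surj m.
  (* An arbitrary [m] differs from its representative by an isomorphism; this lies in [E], so
     naturality of [a] transports the formula. *)
  pose e : @Mor L (mt_dom m) (mt_dom (c i)) := exist _ h (iso_left hi).
  rewrite {1}/inF {1}/inG !(@prim_in_factor _ _ _ (c i) e) //.
  by rewrite compmA tc -[LHS]compmA (ntcN a e) compmA.
have tN x y (phi : @Mor P x y) : t y \oc fmor F phi = fmor G phi \oc t x.
  apply: prim_joint_epi_eq => m; rewrite -[RHS]compmA tP -[LHS]compmA /inG.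
  rewrite [X in _ \oc X = _]compmA [X in _ = X]compmA [X in _ = X \oc _]compmA -!fmorM.
  (* If [phi] is total on [m], naturality of [a] applies to the [E]-part of the resulting map;
     otherwise a proper restriction comes first and both sides vanish on the primitive part. *)
  have [[f ->]|[n [f [nN ->]]]] := partial_or_total (phi \oc tot (mt_mor m)).
    have [u [e [d [Ee Md de]]]] := fs_factor fs f.
    rewrite !(@prim_in_factor _ _ _ (MorTo Md) (exist _ e Ee)) //.
    by rewrite compmA tP -[LHS]compmA (ntcN a) compmA.
  have z0 H : fmor H (tot f \oc restr n) \oc pin H (mt_dom m) = 0%R.
    by rewrite fmorM -compmA core_in_primitive ?compm0.
  by rewrite !z0 comp0m compm0.
exists (NatTrans tN); apply: nattransP => x /=.
have := tP x (MorTo (fs_right1 fs x)).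
rewrite /inF /inG /= !(fmor1 F, fmor1 G) !comp1m /prim_nat => ->.
by rewrite compmA prim_inK comp1m.
Qed.

(** * Essential surjectivity: extending a functor from [E] to [Par] *)

Section Extension.
Hypothesis sums : has_finite_direct_sums X.
Variable G : functor L X.

Record subobject_sum (x : A) : Type := SubobjectSum {
  ss_size : nat;
  ss_sub : 'I_ss_size -> mor_to M x;
  ss_ob : X;
  ss_in : forall i, Mor (G (mt_dom (ss_sub i))) ss_ob;
  ss_out : forall i, Mor ss_ob (G (mt_dom (ss_sub i)));
  ss_surj : forall m, exists i, mor_to_iso m (ss_sub i);
  ss_inj : forall i j, mor_to_iso (ss_sub i) (ss_sub j) -> i = j;
  ss_inK : forall i, ss_out i \oc ss_in i = id_mor _;
  ss_in0 : forall i j, i != j -> ss_out j \oc ss_in i = 0%R;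
  ss_sum : (\sum_i ss_in i \oc ss_out i)%R = id_mor ss_ob }.

Lemma subobject_sum_inhabited (x : A) : inhabited (subobject_sum x).
Proof.
have [n [c [c_surj c_inj]]] := subobject_transversal (fin x).
have [S [inj [proj [K Z s]]]] := sums (fun i => G (mt_dom (c i))).
by constructor; apply: (@SubobjectSum x n c S inj proj).
Qed.

Definition ss (x : A) : subobject_sum x :=
  inhabited_witness (subobject_sum_inhabited x).

Notation sub x := (ss_sub (s := ss x)).
Notation inj x := (ss_in (s := ss x)).
Notation proj x := (ss_out (s := ss x)).

Lemma ss_joint_epi (x : A) (W : X) (y y' : Mor (ss_ob (ss x)) W) :
  (forall i, y \oc inj x i = y' \oc inj x i) -> y = y'.
Proof.
move=> yy'; rewrite -[y]compm1 -[y']compm1 -ss_sum !compm_sumr.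
by apply: eq_bigr => i _; rewrite !compmA yy'.
Qed.

Lemma ss_factor (x y : A) (f : Mor x y) :
  exists j (e : @Mor L x (mt_dom (sub y j))), mt_mor (sub y j) \oc sval e = f.
Proof.
have [u [e [d [Ee Md <-]]]] := fs_factor fs f.
have [j [h [hi cd]]] := ss_surj (ss y) (MorTo Md).
exists j, (exist _ (h \oc e) (fs_leftM fs (iso_left hi) Ee)).
by rewrite /= compmA cd.
Qed.

(** Orthogonality gives mutually inverse comparisons of the two images, so the indices agree, and
    then the [E]-parts agree by monicity. This makes the action on summands well defined. *)
Lemma ss_factor_uniq (x y : A) j k (e : @Mor L x (mt_dom (sub y j)))
    (f : @Mor L x (mt_dom (sub y k))) :
  mt_mor (sub y j) \oc sval e = mt_mor (sub y k) \oc sval f ->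
  inj y j \oc fmor G e = inj y k \oc fmor G f.
Proof.
move=> ef; have jk : j = k.
  have [w [[_ kw] _]] := (fs_left fs _).1 (svalP e) _ _ _ (mt_in (sub y k)) _ _ (esym ef).
  have [w' [[_ jw'] _]] := (fs_left fs _).1 (svalP f) _ _ _ (mt_in (sub y j)) _ _ ef.
  apply: (ss_inj (s := ss y)); exists w; split=> //; exists w'; split.
    by apply: (mono (mt_in (sub y j))); rewrite compmA jw' kw compm1.
  by apply: (mono (mt_in (sub y k))); rewrite compmA kw jw' compm1.
subst k; congr (_ \oc fmor G _); case: e f ef => [e Ee] [f Ef] /= ef.
exact/eq_exist/(mono (mt_in (sub y j))).
Qed.

(** The columns of [h]: a summand on which [phi] is total goes to the summand of its image through
    the [E]-part, and any other summand goes to zero. *)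
Definition is_ext_mor (x y : A) (phi : @Mor P x y)
    (h : Mor (ss_ob (ss x)) (ss_ob (ss y))) : Prop :=
  (forall i j (e : @Mor L (mt_dom (sub x i)) (mt_dom (sub y j))),
     phi \oc tot (mt_mor (sub x i)) = tot (mt_mor (sub y j) \oc sval e) ->
     h \oc inj x i = inj y j \oc fmor G e) /\
  (forall i, (forall f, phi \oc tot (mt_mor (sub x i)) <> tot f) ->
     h \oc inj x i = 0%R).

Lemma ext_mor_ex (x y : A) (phi : @Mor P x y) : exists h, is_ext_mor phi h.
Proof.
have col i : exists h : Mor (G (mt_dom (sub x i))) (ss_ob (ss y)),
    (forall j (e : @Mor L (mt_dom (sub x i)) (mt_dom (sub y j))),
       phi \oc tot (mt_mor (sub x i)) = tot (mt_mor (sub y j) \oc sval e) ->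
       h = inj y j \oc fmor G e) /\
    ((forall f, phi \oc tot (mt_mor (sub x i)) <> tot f) -> h = 0%R).
  have [[f phif]|phiN] := pselect (exists f, phi \oc tot (mt_mor (sub x i)) = tot f).
    have [j [e ef]] := ss_factor f.
    exists (inj y j \oc fmor G e); split=> [k e'|/(_ f)//].
    by rewrite phif => /tot_inj; rewrite -ef => /ss_factor_uniq.
  exists 0%R; split=> // j e phie; case: phiN.
  by exists (mt_mor (sub y j) \oc sval e).
exists (\sum_i sval (cid (col i)) \oc proj x i)%R.
have colE i : (\sum_i sval (cid (col i)) \oc proj x i)%R \oc inj x i = sval (cid (col i)).
  rewrite compm_suml (bigD1 i) //= big1 => [|j ji].
    by rewrite addr0 -compmA ss_inK compm1.
  by rewrite -compmA ss_in0 ?compm0 // eq_sym.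
by split=> i; rewrite colE; case: (svalP (cid (col i))) => H1 H2; [exact: H1|exact: H2].
Qed.

Definition ext_mor (x y : P) (phi : Mor x y) :
    Mor (ss_ob (ss x)) (ss_ob (ss y)) := sval (cid (ext_mor_ex phi)).

Lemma ext_mor_in (x y : A) (phi : @Mor P x y) i j
    (e : @Mor L (mt_dom (sub x i)) (mt_dom (sub y j))) :
  phi \oc tot (mt_mor (sub x i)) = tot (mt_mor (sub y j) \oc sval e) ->
  ext_mor phi \oc inj x i = inj y j \oc fmor G e.
Proof. exact: (svalP (cid (ext_mor_ex phi))).1. Qed.

Lemma ext_mor_in0 (x y : A) (phi : @Mor P x y) i :
  (forall f, phi \oc tot (mt_mor (sub x i)) <> tot f) ->
  ext_mor phi \oc inj x i = 0%R.
Proof. exact: (svalP (cid (ext_mor_ex phi))).2. Qed.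

Lemma ext_mor1 (x : P) : ext_mor (id_mor x) = id_mor _.
Proof.
apply: ss_joint_epi => i; rewrite (@ext_mor_in _ _ _ _ i (id_mor _)) /=.
  by rewrite (fmor1 G) compm1 comp1m.
by rewrite compm1; exact: (@comp1m P).
Qed.

(** The composite is total on a subobject exactly when [phi] is total there and [psi] is total on
    the image, so the zero columns of both sides match. *)
Lemma ext_morM (x y z : P) (psi : Mor y z) (phi : Mor x y) :
  ext_mor (psi \oc phi) = ext_mor psi \oc ext_mor phi.
Proof.
apply: ss_joint_epi => i; rewrite -[RHS]compmA.
have [[f phif]|phiN] := pselect (exists f, phi \oc tot (mt_mor (sub x i)) = tot f).
  have [j [e ef]] := ss_factor f; rewrite -{}ef in phif.
  rewrite (ext_mor_in phif) compmA.
  have [[g psig]|psiN] := pselect (exists g, psi \oc tot (mt_mor (sub y j)) = tot g).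
    have [k [e' eg]] := ss_factor g; rewrite -{}eg in psig.
    rewrite (ext_mor_in psig) -compmA -fmorM; apply: ext_mor_in.
    by rewrite -compmA phif totM compmA psig -totM /= compmA.
  rewrite [X in _ = X \oc _]ext_mor_in0 ?comp0m => [|g psig]; last by apply: psiN; exists g.
  apply: ext_mor_in0 => g; rewrite -compmA phif totM compmA.
  by move=> /(total_comp_left (svalP e)).
have phi0 f : phi \oc tot (mt_mor (sub x i)) <> tot f by move=> phif; apply: phiN; exists f.
rewrite (ext_mor_in0 phi0) compm0; apply: ext_mor_in0 => f.
by rewrite -compmA => /total_comp_right.
Qed.

Definition ext : functor P X := Functor ext_mor1 ext_morM.

(** The whole object is among the chosen representatives only up to isomorphism; [h] and [h']
    identify [x] with that representative inside [E]. *)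
Lemma ss_top_ex (x : A) :
  exists t (h : @Mor L x (mt_dom (sub x t))) (h' : @Mor L (mt_dom (sub x t)) x),
    [/\ h \oc h' = id_mor _, h' \oc h = id_mor _ & sval h' = mt_mor (sub x t)].
Proof.
have [t [h [hi ch]]] := ss_surj (ss x) (MorTo (fs_right1 fs x)).
have [h' [h'h hh']] := hi.
have h'E : h' = mt_mor (sub x t) by rewrite -[RHS]compm1 -hh' compmA ch comp1m.
have h'i : is_iso h' by exists h.
exists t, (exist _ h (iso_left hi)), (exist _ h' (iso_left h'i)).
by split=> //; apply: eq_exist.
Qed.

Lemma ext_tot_in (x y : A) (t : _) (h : @Mor L x (mt_dom (sub x t)))
    (h' : @Mor L (mt_dom (sub x t)) x) (f : Mor x y) (j : _)
    (e : @Mor L x (mt_dom (sub y j))) :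
  h' \oc h = id_mor _ -> sval h' = mt_mor (sub x t) ->
  mt_mor (sub y j) \oc sval e = f ->
  fmor ext (tot f) \oc (inj x t \oc fmor G h) = inj y j \oc fmor G e.
Proof.
move=> h'h h'E ef; rewrite compmA (@ext_mor_in _ _ _ t j (e \oc h')).
  by rewrite -compmA -fmorM -compmA h'h compm1.
by rewrite -totM /= -ef h'E compmA.
Qed.

(** [s] and [r] are the inclusion and the projection of the summand of [ext x]
    indexed by the top subobject of [x]. *)
Lemma ext_core (x : A) : exists (s : Mor (G x) (ext x)) (r : Mor (ext x) (G x)),
  [/\ r \oc s = id_mor _, primitive s,
      forall (W : X) (y : Mor (ext x) W), coprimitive y -> y \oc s \oc r = y
    & forall (y : A) (f : Mor x y) (j : _) (e : @Mor L x (mt_dom (sub y j))),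
        mt_mor (sub y j) \oc sval e = f ->
        fmor ext (tot f) \oc s = inj y j \oc fmor G e].
Proof.
have [t [h [h' [hh' h'h h'E]]]] := ss_top_ex x.
exists (inj x t \oc fmor G h), (fmor G h' \oc proj x t); split; last 1 first.
- by move=> y f j e; apply: ext_tot_in h'h h'E.
- rewrite -compmA (compmA (proj x t)) ss_inK comp1m -fmorM h'h.
  exact: fmor1.
(* If [restr m] were total on the top representative, [m] would be invertible. *)
- move=> m mN; rewrite compmA [X in X \oc _]ext_mor_in0 ?comp0m // => f.
  rewrite -h'E => dmf; apply: mN.
  apply: (@tot_restr_tot_iso _ _ m (id_mor _) (f \oc sval h)).
  rewrite totM -dmf -compmA -totM.
  have -> : sval h' \oc sval h = id_mor x by have /(congr1 sval) := h'h.
  by rewrite (@compm1 P) (@comp1m P).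
move=> W y yP; apply: ss_joint_epi => i; rewrite -!compmA.
have [->|it] := eqVneq i t.
  by rewrite ss_inK compm1 -fmorM hh' (fmor1 G) compm1.
rewrite ss_in0 // !compm0; apply/esym.
have iN : ~ is_iso (mt_mor (sub x i)).
  move=> [k [ki ik]]; case/eqP: it; apply: (ss_inj (s := ss x)).
  have hi : is_iso (sval h).
    by exists (sval h'); split; [have /(congr1 sval) := h'h|have /(congr1 sval) := hh'].
  exists (sval h \oc mt_mor (sub x i)); split; first by apply: isoM => //; exists k.
  rewrite compmA -h'E.
  by have /(congr1 sval) /= -> := h'h; rewrite comp1m.
(* The inclusion of summand [i] is the top summand of [ext (mt_dom (sub x i))] followed by the image
   of a proper inclusion, which the coprimitive [y] kills. *)
have [t' [k [k' [_ k'k k'E]]]] := ss_top_ex (mt_dom (sub x i)).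
have := @ext_tot_in _ x t' k k' _ i (id_mor _) k'k k'E erefl.
rewrite compm1 (fmor1 G) compm1 => <-.
by rewrite compmA yP ?comp0m.
Qed.

(** Both [s x] and [pin ext x] are split inclusions of the primitive part of [ext x], so
    [pout ext x \oc s x] is invertible with inverse [r x \oc pin ext x]. *)
Lemma prim_functor_ess_surj : exists F, isomorphic (prim_functor F) (G : functor_category L X).
Proof.
exists ext.
pose s x := sval (cid (ext_core x)).
pose r x := sval (cid (svalP (cid (ext_core x)))).
have sr x := svalP (cid (svalP (cid (ext_core x)))).
have rs x : r x \oc s x = id_mor _ by case: (sr x).
have sP x : primitive (s x) by case: (sr x).
have yK x (W : X) (y : Mor (ext x) W) : coprimitive y -> y \oc s x \oc r x = y.
  by case: (sr x) => _ _ H _; apply: H.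
have sN (x y : L) (e : Mor x y) : fmor ext (tot (sval e)) \oc s x = s y \oc fmor G e.
  (* Factoring the identity of [y] writes [s y] as a summand inclusion after [fmor G f], and
     [f \oc e] is then an [E]-part of [e]. *)
  have [j [f]] := ss_factor (id_mor (y : A)); case: (sr x) (sr y) => _ _ _ Hx [_ _ _ Hy] fy.
  have -> : s y = inj y j \oc fmor G f.
    by rewrite -(Hy _ _ _ _ fy) (fmor1 ext) comp1m.
  rewrite -compmA -fmorM; apply: Hx.
  by rewrite /= compmA fy comp1m.
have tN (x y : L) (e : Mor x y) :
    (pout ext y \oc s y) \oc fmor G e = fmor (prim ext) e \oc (pout ext x \oc s x).
  by rewrite -!compmA -sN primitiveK.
pose t := @NatTrans L X G (prim ext) _ tN.
suff [u [ut tu]] : @is_iso (functor_category L X) _ _ t by exists u, t.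
apply: nattrans_is_iso => x; exists (r x \oc pin ext x); split => /=.
  by rewrite -compmA primitiveK.
by rewrite compmA yK ?prim_inK //; apply: core_out_coprimitive.
Qed.

End Extension.
End Equivalence.
End Factorization.

Theorem mainTheorem3 (A : category) (E M : mor_class A)
    (fs : factorization_system E M)
    (pb : pullback_stable M)
    (mono : forall (a b : A) (m : Mor a b), M a b m -> monomorphism m)
    (fin : forall x : A, finite_set [set: subobject M x])
    (X : additive_category)
    (sums : has_finite_direct_sums X)
    (splits : idempotents_split X) :
  equivalent (functor_category (Par fs pb) X)
             (functor_category (left_category fs) X).
Proof.
apply: (full_faithful_ess_surj_equivalent (Phi := prim_functor fs mono pb fin splits)).
- exact: prim_functor_full.
- exact: prim_functor_faithful.
exact: prim_functor_ess_surj sums.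
Qed.
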